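(* Let $\partial_t q+J_x\partial_x q+J_y\partial_y q=0$, $q:\mathbb R^+_0\times\mathbb R^2\to\mathbb R^n$, be a linear hyperbolic system with constant $n\times n$ matrices $J_x,J_y$, and let $T_t$ be its evolution operator. Let $A$ be the sliding average operator over a cell of size $\Delta x\times\Delta y$, let $\Delta t>0$, and let $q^n_{\mathrm{recon}}:\mathbb R^2\to\mathbb R^n$ be a reconstruction of discrete cell data $\{q^n_{ij}\}$. Then, provided all expressions exist, the two operators commute: for every cell center $\mathbf x_{ij}$, $$(A\,T_{\Delta t}\,q^n_{\mathrm{recon}})(\mathbf x_{ij})=(T_{\Delta t}\,A\,q^n_{\mathrm{recon}})(\mathbf x_{ij}).$$
   Context: The evolution operator $T_t$ maps suitable initial data $q_0$ to the solution at time $t$ of the Cauchy problem for the system with $q(0,\mathbf x)=q_0(\mathbf x)$; this solution is assumed to exist and be unique. The sliding average of $q:\mathbb R^2\to\mathbb R^n$ is $$(Aq)(\mathbf x)=\frac1{\Delta x\,\Delta y}\int_{[-\frac{\Delta x}2,\frac{\Delta x}2]\times[-\frac{\Delta y}2,\frac{\Delta y}2]}q(\mathbf x+\mathbf s)\,d\mathbf s .$$ The grid is an equidistant Cartesian grid with cells of size $\Delta x\times\Delta y$ and centers $\mathbf x_{ij}$; a reconstruction is a function $q^n_{\mathrm{recon}}$ obtained from the discrete values with $(Aq^n_{\mathrm{recon}})(\mathbf x_{ij})=q^n_{ij}$, for instance the piecewise constant one, equal to $q^n_{ij}$ in cell $(i,j)$. *)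

(* Defs.v *)
From HB Require Import structures.
From mathcomp Require Export all_boot all_order all_algebra.
From mathcomp Require Export all_classical all_reals all_analysis.
Import Order.TTheory GRing.Theory Num.Theory.
Export numFieldNormedType.Exports.
Set Implicit Arguments.
Unset Strict Implicit.
Unset Printing Implicit Defensive.
Local Open Scope classical_set_scope.
Local Open Scope ring_scope.

Notation lebesgue2 R := (@lebesgue_measure R \x @lebesgue_measure R)%E.

(* Real diagonalizability in every direction, as the scalar field is real. *)
Definition hyperbolic (R : realType) (n : nat) (Jx Jy : 'M[R]_n) : Prop :=
  forall a b : R, diagonalizable (a *: Jx + b *: Jy).

Definition box (R : realType) (a b : R) : set (R * R) :=
  `[- a, a]%classic `*` `[- b, b]%classic.

Definition sliding_average (R : realType) (n : nat) (dx dy : R)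
    (q : R * R -> 'cV[R]_n) (x : R * R) : 'cV[R]_n :=
  \col_i ((dx * dy)^-1 *
    \int[lebesgue2 R]_(s in box (dx / 2) (dy / 2)) q (x + s) i 0).

Definition loc_integrable (R : realType) (n : nat)
    (q : R * R -> 'cV[R]_n) : Prop :=
  forall (i : 'I_n) (r : R),
    (lebesgue2 R).-integrable (box r r) (fun x => (q x i 0)%:E).

(* Points of space-time are pairs (t, (x, y)). *)
Definition e_t (R : realType) : R * (R * R) := (1, (0, 0)).
Definition e_x (R : realType) : R * (R * R) := (0, (1, 0)).
Definition e_y (R : realType) : R * (R * R) := (0, (0, 1)).

(* C^1, with compact support in the open half-space t > 0. *)
Definition test_function (R : realType) (phi : R * (R * R) -> R) : Prop :=
  [/\ continuous phi,
      forall v : R * (R * R), v \in [:: e_t R; e_x R; e_y R] ->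
        (forall p : R * (R * R), derivable phi p v) /\ continuous ('D_v phi)
    & exists K : set (R * (R * R)),
        [/\ compact K, K `<=` [set p | 0 < p.1]
          & forall p, ~ K p -> phi p = 0]].

(* Initial data such as a piecewise constant function are discontinuous, so
   the Cauchy problem is understood in the sense of distributions:
   q lies in C([0, +oo); L^1_loc), equals q0 at t = 0, and
   d_t q + Jx d_x q + Jy d_y q = 0 holds weakly for t > 0.  The values of q at
   negative times play no role. *)
Definition weak_solution (R : realType) (n : nat) (Jx Jy : 'M[R]_n)
    (q0 : R * R -> 'cV[R]_n) (q : R -> R * R -> 'cV[R]_n) : Prop :=
  [/\ forall t : R, 0 <= t -> loc_integrable (q t),
      forall (t0 r : R) (i : 'I_n), 0 <= t0 ->
        (\int[lebesgue2 R]_(x in box r r) `|q t x i 0 - q t0 x i 0|)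
          @[t --> within `[0, +oo[ (nbhs t0)] --> (0 : R),
      q 0 = q0 %[ae lebesgue2 R]
    & forall (phi : R * (R * R) -> R) (i : 'I_n), test_function phi ->
        \int[@lebesgue_measure R]_(t in `]0, +oo[)
          \int[lebesgue2 R]_x
            (q t x i 0 * 'D_(e_t R) phi (t, x)
             + (Jx *m q t x) i 0 * 'D_(e_x R) phi (t, x)
             + (Jy *m q t x) i 0 * 'D_(e_y R) phi (t, x)) = 0].

(* Suitable initial data: the solution exists and is unique. *)
Definition well_posed (R : realType) (n : nat) (Jx Jy : 'M[R]_n)
    (q0 : R * R -> 'cV[R]_n) : Prop :=
  [/\ loc_integrable q0,
      exists q, weak_solution Jx Jy q0 q
    & forall q q', weak_solution Jx Jy q0 q -> weak_solution Jx Jy q0 q' ->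
        forall t : R, 0 <= t -> q t = q' t %[ae lebesgue2 R]].

(* A weak solution at time t is only an almost-everywhere class.  Its point
   values are those of the continuous representative whenever there is one
   (it is then unique); otherwise an arbitrary representative is taken. *)
Definition evolution (R : realType) (n : nat) (Jx Jy : 'M[R]_n) (t : R)
    (q0 : R * R -> 'cV[R]_n) : R * R -> 'cV[R]_n :=
  let q := xget (fun _ _ => 0) [set q | weak_solution Jx Jy q0 q] in
  xget (q t) [set f | continuous f /\ f = q t %[ae lebesgue2 R]].

(* c is the center of the cell (0, 0). *)
Definition cell_center (R : realType) (dx dy : R) (c : R * R) (i j : int) :
  R * R := (c.1 + i%:~R * dx, c.2 + j%:~R * dy).

Definition reconstruction (R : realType) (n : nat) (dx dy : R) (c : R * R)
    (qd : int -> int -> 'cV[R]_n) (q : R * R -> 'cV[R]_n) : Prop :=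
  forall i j, sliding_average dx dy q (cell_center dx dy c i j) = qd i j.

(* Main.v *)
(* Let q be the weak solution with data q_recon.  Then t |-> A q(t) is a weak
   solution with data A q_recon: testing it against phi amounts, since the cell
   is symmetric and hence A is self-adjoint (Fubini), to testing q against
   A phi, and A phi is again a test function because A commutes with every
   partial derivative.  By uniqueness T_dt (A q_recon) = A (q(dt)) almost
   everywhere.  The right-hand side is continuous, the average of a locally
   integrable function being so, hence it is the representative selected by the
   evolution operator and the equality holds at every point. *)
From HB Require Import structures.
Require Import Defs.
From mathcomp Require Import all_boot all_order all_algebra.
From mathcomp Require Import all_classical all_reals all_analysis.
From mathcomp Require Import measurable_realfun ring lra.
Import Order.TTheory GRing.Theory Num.Theory.
Set Implicit Arguments.
Unset Strict Implicit.
Unset Printing Implicit Defensive.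
Local Open Scope classical_set_scope.
Local Open Scope ring_scope.

(** * Lebesgue measure on the plane *)

Local Notation plane R := (measurableTypeR R * measurableTypeR R)%type.

(** The data are merely locally integrable and averaging integrates against a discontinuous
    indicator, so regularity has two different sources. Averages of data are continuous because a
    small move of the center changes the indicator only in thin strips along the lines carrying the
    cell edges, and the mass of these strips tends to 0 by dominated convergence. Averages of test
    functions are differentiated by the mean value theorem together with uniform continuity over the
    compact cell, so the indicator is never differentiated. Fubini requires integrability on a
    product of two planes; compact support of the test function makes only a bounded part of the
    data matter. Continuity in time survives averaging because an average over a cell is bounded by
    the L^1 norm on a larger box. On the left-hand side the representative chosen by [evolution] is
    harmless, since averages do not see null sets. *)

Lemma open_measurable_plane (R : realType) (U : set (R * R)) :
  open U -> measurable (U : set (plane R)).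
Proof.
move=> oU.
pose rect (q : (rat * rat) * (rat * rat)) : set (plane R) :=
  (`]ratr q.1.1 : R, ratr q.1.2[ `*` `]ratr q.2.1 : R, ratr q.2.2[)%classic.
(* Rectangles with rational corners that are not contained in [U] are replaced by the empty set, so
   the union runs over a countable type. *)
have -> : U = \bigcup_q (if pselect (rect q `<=` U) then rect q else set0).
  apply/seteqP; split => [[x y] Uxy|z [q _]]; last first.
    by case: pselect => //= qU; exact: qU.
  have /nbhs_ballP[e /= e0 eU] : nbhs (x, y) U by exact: open_nbhs_nbhs.
  have lo (z : R) : z - e < z by rewrite ltrBlDr ltrDl.
  have hi (z : R) : z < z + e by rewrite ltrDl.
  have [a1 /[!in_itv]/= /andP[? ?]] := rat_in_itvoo (lo x).
  have [b1 /[!in_itv]/= /andP[? ?]] := rat_in_itvoo (hi x).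
  have [a2 /[!in_itv]/= /andP[? ?]] := rat_in_itvoo (lo y).
  have [b2 /[!in_itv]/= /andP[? ?]] := rat_in_itvoo (hi y).
  exists ((a1, b1), (a2, b2)) => //.
  case: pselect => [qU|[]]; first by split; rewrite /= in_itv/=; apply/andP.
  move=> [u v] [] /=; rewrite !in_itv/= => /andP[? ?] /andP[? ?]; apply: eU.
  by split; rewrite /ball/= ltr_norml; apply/andP; split; lra.
apply: countable_bigcupT_measurable => [|q]; first exact: countableP.
case: pselect => qU /=; last exact: measurable0.
by apply: measurableX; exact: measurable_itv.
Qed.

Lemma continuous_measurable_plane (R : realType) (f : R * R -> R) :
  continuous f -> measurable_fun [set: plane R] (f : plane R -> measurableTypeR R).
Proof.
move=> /continuousP cf; apply: (measurability _ (RGenOpens.measurableE R)).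
move=> _ [_ [a [b ->] <-]]; rewrite setTI; apply: open_measurable_plane.
exact/cf/interval_open.
Qed.

Lemma lebesgue_measure_shift (R : realType) (a : R) (A : set R) :
  measurable (A : set (measurableTypeR R)) ->
  pushforward (@lebesgue_measure R) (fun x : measurableTypeR R => a + x : measurableTypeR R) A
  = lebesgue_measure A.
Proof.
have ma : measurable_fun setT (fun x : measurableTypeR R => a + x : measurableTypeR R).
  exact: measurable_funD.
move=> mA; apply/esym/lebesgue_measure_unique => //= _ [[u v]] _ <-.
rewrite /pushforward (_ : _ @^-1` _ = `]u - a, v - a]%classic); last first.
  by apply/seteqP; split => x /=; rewrite !in_itv/= ltrBlDl lerBrDl.
rewrite !lebesgue_measure_itv/= !lte_fin ltrD2r.
by rewrite -!EFinD opprB addrA subrK.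
Qed.

Lemma measurable_shift (R : realType) (x : R * R) :
  measurable_fun setT (fun s : plane R => x + s : plane R).
Proof.
apply/measurable_fun_pairP; split => /=.
  by apply: measurable_funD => //; exact: measurable_fst.
by apply: measurable_funD => //; exact: measurable_snd.
Qed.

(** A product measure is determined by its values on measurable rectangles, and translates of
    rectangles are rectangles; this reduces the claim to the line. *)
Lemma lebesgue2_shift (R : realType) (x : R * R) (A : set (plane R)) :
  measurable A ->
  pushforward (lebesgue2 R) (fun s : plane R => x + s : plane R) A
  = lebesgue2 R A.
Proof.
have mx := measurable_shift x.
move=> mA; apply/esym/product_measure_unique => //= B C mB mC.
rewrite /pushforward.
rewrite (_ : _ @^-1` _ = ((fun s => x.1 + s) @^-1` B) `*` ((fun s => x.2 + s) @^-1` C)); last first.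
  by apply/seteqP; split.
have mp (a : R) (D : set (measurableTypeR R)) : measurable D ->
    measurable ((fun s : measurableTypeR R => a + s : measurableTypeR R) @^-1` D).
  move=> mD; rewrite -[X in measurable X]setTI.
  by apply: measurable_funD => //.
rewrite product_measure1E//; [|exact: mp|exact: mp].
by congr (_ * _)%E; exact: lebesgue_measure_shift.
Qed.

Lemma ge0_integral_shift (R : realType) (x : R * R) (f : plane R -> \bar R) :
  measurable_fun setT f -> (forall y, (0 <= f y)%E) ->
  (\int[lebesgue2 R]_s f (x + s)%R = \int[lebesgue2 R]_y f y)%E.
Proof.
move=> mf f0.
have := @ge0_integral_pushforward _ _ (plane R) (plane R) R _
  (measurable_shift x) (lebesgue2 R) setT f measurableT mf (fun y _ => f0 y).
rewrite preimage_setT => <-.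
apply: eq_measure_integral; first exact: measurable_shift.
by move=> mx A mA _; exact: lebesgue2_shift.
Qed.

(** Treating positive and negative parts separately makes measurability sufficient: both sides are
    the same difference, finite or not. *)
Lemma integral_shift (R : realType) (x : R * R) (f : plane R -> \bar R) :
  measurable_fun setT f ->
  (\int[lebesgue2 R]_s f (x + s)%R = \int[lebesgue2 R]_y f y)%E.
Proof.
move=> mf; rewrite integralE [RHS]integralE; congr (_ - _)%E.
  rewrite -(ge0_integral_shift x (measurable_funepos mf) (funepos_ge0 f)).
  by apply: eq_integral => s _; exact: (congr1 (@^~ s) (funepos_comp f (+%R x))).
rewrite -(ge0_integral_shift x (measurable_funeneg mf) (funeneg_ge0 f)).
by apply: eq_integral => s _; exact: (congr1 (@^~ s) (funeneg_comp f (+%R x))).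
Qed.

Lemma measurable_box (R : realType) (a b : R) :
  measurable (box a b : set (plane R)).
Proof. by apply: measurableX; exact: measurable_itv. Qed.

Lemma lebesgue2_box (R : realType) (a b : R) :
  (lebesgue2 R (box a b) < +oo)%E.
Proof.
rewrite product_measure1E; [|exact: measurable_itv|exact: measurable_itv].
by rewrite /= !lebesgue_measure_itv/=; do 2 case: ifP => _;
  rewrite ?mule0 ?mul0e// -?EFinB -?EFinM ltry.
Qed.

Lemma compact_box (R : realType) (a b : R) : compact (box a b).
Proof. by apply: compact_setX; exact: segment_compact. Qed.

(** Scalar counterpart of [loc_integrable]; the analysis is done one coordinate at a time. *)
Definition loc_integrable1 (R : realType) (w : R * R -> R) :=
  forall r : R, (lebesgue2 R).-integrable (box r r) (EFin \o w).

Lemma continuous_loc_integrable (R : realType) (w : R * R -> R) :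
  continuous w -> loc_integrable1 w.
Proof.
move=> cw r; apply: measurable_bounded_integrable.
- exact: measurable_box.
- exact: lebesgue2_box.
- by apply: measurable_funTS; exact: continuous_measurable_plane.
have : bounded_set (w @` box r r).
  apply: compact_bounded; apply: continuous_compact (@compact_box R r r).
  exact: continuous_subspaceT.
by move=> [M [Mr HM]]; exists M; split => // N /HM{}HM x ?; apply: HM; exists x.
Qed.

Lemma box_subset (R : realType) (a b c d : R) :
  a <= c -> b <= d -> box a b `<=` box c d.
Proof.
move=> ac bd [x y] [] /=; rewrite !in_itv/= => /andP[? ?] /andP[? ?].
by split; rewrite /= in_itv/=; apply/andP; split; lra.
Qed.

Lemma loc_integrable_box (R : realType) (w : R * R -> R) (a b : R) :
  loc_integrable1 w -> (lebesgue2 R).-integrable (box a b) (EFin \o w).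
Proof.
move=> /(_ (Num.max a b)); apply: integrableS; [exact: measurable_box..|].
by apply: box_subset; rewrite le_max lexx ?orbT.
Qed.

Lemma bigcup_box (R : realType) : \bigcup_n box (n%:R : R) n%:R = setT.
Proof.
apply/seteqP; split => // -[x y] _.
exists (Num.truncn (`|x| + `|y|)).+1 => //=.
have : `|x| + `|y| < (Num.truncn (`|x| + `|y|)).+1%:R by exact: truncnS_gt.
move: (_%:R) => n xyn.
have := (ler_norm x, ler_norm (- x), ler_norm y, ler_norm (- y)).
rewrite !normrN => -[[[? ?] ?] ?].
have := normr_ge0 x; have := normr_ge0 y.
by split; rewrite /= in_itv/=; apply/andP; split; lra.
Qed.

Lemma loc_integrable_measurable (R : realType) (w : R * R -> R) :
  loc_integrable1 w -> measurable_fun [set: plane R] (w : plane R -> measurableTypeR R).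
Proof.
move=> lw; rewrite -bigcup_box; apply/measurable_fun_bigcup => n.
  exact: measurable_box.
by apply/measurable_EFinP; have /integrableP[] := lw n%:R.
Qed.

(** On the box the continuous factor is bounded by compactness, and off the box the product
    vanishes. *)
Lemma loc_integrableM (R : realType) (w g : R * R -> R) (r : R) :
  loc_integrable1 w -> continuous g -> (forall x, ~ box r r x -> g x = 0) ->
  (lebesgue2 R).-integrable setT (fun x => (w x * g x)%:E).
Proof.
move=> lw cg g0.
have : (lebesgue2 R).-integrable (box r r) (EFin \o (fun x => w x * g x)).
  have : bounded_set (g @` box r r).
    apply: compact_bounded; apply: continuous_compact (@compact_box R r r).
    exact: continuous_subspaceT.
  move=> [M [Mr HM]].
  apply: (@integrableMl _ _ _ _ _ (measurable_box r r) (EFin \o w) g).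
  - exact: lw.
  - by apply: measurable_funTS; exact: continuous_measurable_plane.
  - by exists M; split => // N /HM{}HM x ?; apply: HM; exists x.
move=> /integrable_mkcond; rewrite /= => /(_ (measurable_box r r)).
apply: eq_integrable => //= x _; rewrite patchE; case: ifPn => //.
by rewrite notin_setE => /g0 ->; rewrite mulr0.
Qed.

Lemma loc_integrable_restrict (R : realType) (w : R * R -> R) (a b : R) :
  loc_integrable1 w -> (lebesgue2 R).-integrable setT (EFin \o (w \_ (box a b))).
Proof.
move=> lw; have := loc_integrable_box a b lw => /integrable_mkcond.
move=> /(_ (measurable_box _ _)).
by apply: eq_integrable => // y _; rewrite /= !patchE; case: ifP.
Qed.

(** * The averaging operator *)

(* The indicator that y lies in the closed cell centered at x.  The average of w
   at x is an integral of [window x y * w y], and the symmetry of the window in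
   x and y is what makes averaging self-adjoint. *)
Definition window (R : realType) (a b : R) (x y : R * R) : R :=
  ((`|y.1 - x.1| <= a) && (`|y.2 - x.2| <= b))%:R.

Lemma windowC (R : realType) (a b : R) (x y : R * R) :
  window a b x y = window a b y x.
Proof. by rewrite /window distrC (distrC y.2). Qed.

Lemma windowE (R : realType) (a b : R) (x y : R * R) :
  window a b x y = \1_(box a b) (y - x).
Proof.
rewrite indicE /window; congr (_ : bool)%:R; apply/idP/idP => [|/set_mem[]].
  by move=> /andP[h1 h2]; apply/mem_set; split; rewrite /= in_itv/= -ler_norml.
by rewrite /= !in_itv/= -!ler_norml => -> ->.
Qed.

Lemma window_ge0 (R : realType) (a b : R) (x y : R * R) : 0 <= window a b x y.
Proof. exact: ler0n. Qed.

Lemma window_le1 (R : realType) (a b : R) (x y : R * R) : window a b x y <= 1.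
Proof. by rewrite /window; case: (_ && _). Qed.

(** The triangle inequality in each coordinate would allow r + a and r + b; the radius r + a + b
    covers both and keeps the enlarged box a square. *)
Lemma window_eq0 (R : realType) (a b r : R) (x y : R * R) :
  box r r x -> ~ box (r + a + b) (r + a + b) y -> 0 <= a -> 0 <= b ->
  window a b x y = 0.
Proof.
move=> [/=]; rewrite !in_itv/= -!ler_norml => x1 x2 ny a0 b0.
rewrite /window; case: (boolP (_ && _)) => // /andP[y1 y2]; case: ny.
split; rewrite /= in_itv/= -ler_norml.
  by have := ler_normD (y.1 - x.1) x.1; rewrite subrK; lra.
by have := ler_normD (y.2 - x.2) x.2; rewrite subrK; lra.
Qed.

Lemma measurable_window2 (R : realType) (a b : R) :
  measurable_fun [set: plane R * plane R]
    (fun p => window a b p.1 p.2 : measurableTypeR R).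
Proof.
under eq_fun do rewrite windowE.
apply: (measurableT_comp (f := \1_(box a b) : plane R -> measurableTypeR R)).
  exact: measurable_indic (measurable_box a b).
apply/measurable_fun_pairP; split => /=; apply: measurable_funB.
- by apply: measurableT_comp => //; exact: measurable_fst.
- by apply: measurableT_comp => //; exact: measurable_fst.
- by apply: measurableT_comp => //; exact: measurable_snd.
- by apply: measurableT_comp => //; exact: measurable_snd.
Qed.

Lemma measurable_window (R : realType) (a b : R) (x : R * R) :
  measurable_fun [set: plane R] (window a b x : plane R -> measurableTypeR R).
Proof.
exact: (measurableT_comp (measurable_window2 a b) (pair1_measurable (x : plane R))).
Qed.

Lemma integrable_window (R : realType) (a b : R) (x : R * R) (w : R * R -> R) :
  0 <= a -> 0 <= b -> loc_integrable1 w ->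
  (lebesgue2 R).-integrable setT
    (EFin \o (fun y => window a b x y * w y)).
Proof.
move=> a0 b0 lw.
have [r xr] : exists r, box r r x.
  have : setT x by []. rewrite -(bigcup_box R) => -[n _ xn]; by exists n%:R.
have mr := measurable_box (r + a + b) (r + a + b).
have := lw (r + a + b) => /integrable_mkcond => /(_ mr).
apply: le_integrable => //.
  apply/measurable_EFinP; apply: measurable_funM.
    exact: measurable_window.
  exact: loc_integrable_measurable.
move=> y _ /=; rewrite patchE; case: ifPn => [_|].
  rewrite lee_fin normrM ger0_norm ?window_ge0//.
  by rewrite ler_piMl// window_le1.
by rewrite notin_setE => yr; rewrite (window_eq0 xr yr)// mul0r.
Qed.

Definition avg (R : realType) (dx dy : R) (w : R * R -> R) (x : R * R) : R :=
  (dx * dy)^-1 * \int[lebesgue2 R]_(s in box (dx / 2) (dy / 2)) w (x + s).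

(** Translation invariance replaces the offset s by the point y = x + s, so the dependence on x
    moves from [w] into the kernel. *)
Lemma avgE (R : realType) (dx dy : R) (w : R * R -> R) (x : R * R) :
  loc_integrable1 w ->
  avg dx dy w x =
  (dx * dy)^-1 * \int[lebesgue2 R]_y (window (dx / 2) (dy / 2) x y * w y).
Proof.
move=> lw; congr (_ * _); rewrite Rintegral_mkcond.
have mF : measurable_fun [set: plane R]
    (fun y => (window (dx / 2) (dy / 2) x y * w y)%:E).
  apply/measurable_EFinP; apply: measurable_funM.
    exact: measurable_window.
  exact: loc_integrable_measurable.
rewrite /Rintegral; congr fine; rewrite -(integral_shift x mF).
apply: eq_integral => s _; congr EFin.
by rewrite windowE addrAC subrr add0r patchE indicE; case: ifPn; rewrite ?mul1r ?mul0r.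
Qed.

(* The only points y at which the windows centered at x and at a point within
   distance d of x may differ. *)
Definition frame (R : realType) (a b d : R) (x : R * R) : set (R * R) :=
  [set y | (`| `|y.1 - x.1| - a | <= d) || (`| `|y.2 - x.2| - b | <= d)].

(** If a coordinate of y is farther than d from the cell edges in that direction, moving the center
    by at most d cannot carry it across one. Off the frame this holds in both coordinates and the
    windows agree. *)
Lemma window_dist (R : realType) (a b d : R) (x x' y : R * R) :
  `|x.1 - x'.1| <= d -> `|x.2 - x'.2| <= d ->
  `|window a b x y - window a b x' y| <= \1_(frame a b d x) y.
Proof.
move=> d1 d2; rewrite indicE; have [_|] := boolP (y \in _).
  rewrite /window.
  by case: (_ && _); case: (_ && _); rewrite ?subrr ?subr0 ?sub0r ?normrN ?normr0 ?normr1.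
rewrite notin_setE /frame/= => /negP.
rewrite negb_or -!ltNge => /andP[n1 n2]; rewrite /window.
have aux (u v c : R) : `|u - v| <= d -> d < `|u - c| -> (u <= c) = (v <= c).
  rewrite ler_norml ltr_normr => /andP[? ?] /orP[?|?]; apply/idP/idP => ?; lra.
have close (s t t' : R) : `|t - t'| <= d -> `| `|s - t| - `|s - t'| | <= d.
  move=> td; apply: le_trans (ler_dist_dist _ _) _.
  by rewrite (_ : s - t - (s - t') = - (t - t')) ?normrN//; ring.
rewrite (aux _ `|y.1 - x'.1| a (close _ _ _ d1) n1).
by rewrite (aux _ `|y.2 - x'.2| b (close _ _ _ d2) n2) subrr normr0.
Qed.

Lemma measurable_frame (R : realType) (a b d : R) (x : R * R) :
  measurable (frame a b d x : set (plane R)).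
Proof.
have mnorm (f : plane R -> R) (c e : R) : continuous f ->
    measurable ([set y | `| `|f y| - e | <= c] : set (plane R)).
  move=> cf.
  have cg : continuous (fun y : R * R => `| `|f y| - e|).
    move=> y; apply: cvg_norm; apply: cvgB; last exact: cvg_cst.
    exact: cvg_norm (cf y).
  have := continuous_measurable_plane cg.
  move=> /(_ measurableT _ (measurable_itv `]-oo, c])).
  rewrite setTI [X in measurable X -> _](_ : _ = [set y | `| `|f y| - e | <= c])//.
rewrite /frame (_ : [set _ | _] =
  [set y | `| `|y.1 - x.1| - a | <= d] `|` [set y | `| `|y.2 - x.2| - b | <= d]).
  apply: measurableU; apply: mnorm => y; apply: cvgB; try exact: cvg_cst.
    exact: cvg_fst.
  exact: cvg_snd.
by apply/seteqP; split => y /=; [move/orP|move=> h; apply/orP].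
Qed.

Lemma negligible_vline (R : realType) (c : R) :
  (lebesgue2 R).-negligible [set y | y.1 = c].
Proof.
exists ([set c] `*` setT); split; [exact: measurableX| |by move=> y].
by rewrite product_measure1E//= lebesgue_measure_set1 mul0e.
Qed.

Lemma negligible_hline (R : realType) (c : R) :
  (lebesgue2 R).-negligible [set y | y.2 = c].
Proof.
exists (setT `*` [set c]); split; [exact: measurableX| |by move=> y].
by rewrite product_measure1E//= lebesgue_measure_set1 mule0.
Qed.

(** Dominated convergence with majorant |w|: a point off the four lines carrying the cell edges
    leaves the frame once 1/(n+1) is small enough, and these lines are null. *)
Lemma frame_cvg0 (R : realType) (a b : R) (x : R * R) (w : R * R -> R) :
  (lebesgue2 R).-integrable setT (EFin \o w) ->
  (\int[lebesgue2 R]_y (`|w y| * \1_(frame a b n.+1%:R^-1 x) y)) @[n --> \oo]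
    --> (0 : R).
Proof.
move=> iw.
have mw : measurable_fun [set: plane R] (w : plane R -> measurableTypeR R).
  by apply/measurable_EFinP; case/integrableP : iw.
have := @dominated_convergence _ _ _ (lebesgue2 R) setT measurableT
  (fun n y => (`|w y| * \1_(frame a b n.+1%:R^-1 x) y)%:E) (cst 0%E)
  (fun y => `|w y|%:E).
case.
- move=> n; apply/measurable_EFinP; apply: measurable_funM.
    exact: measurableT_comp.
  exact: measurable_indic (measurable_frame _ _ _ _).
- exact: measurable_cst.
- have : (lebesgue2 R).-negligible
     (([set y | y.1 = x.1 + a] `|` [set y | y.1 = x.1 - a]) `|`
      ([set y | y.2 = x.2 + b] `|` [set y | y.2 = x.2 - b])).
    by apply: negligibleU; apply: negligibleU;
      solve [exact: negligible_vline | exact: negligible_hline].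
  apply: negligibleS => y /=; apply: contra_notP => ny _.
  have e1 : 0 < `| `|y.1 - x.1| - a|.
    rewrite normr_gt0; apply: contra_not_neq ny => /eqP.
    rewrite subr_eq0 eqr_norml => /andP[/orP[]/eqP ya _]; left; [left|right];
      by rewrite -ya addrC ?subrK// opprK addrCA subrr addr0.
  have e2 : 0 < `| `|y.2 - x.2| - b|.
    rewrite normr_gt0; apply: contra_not_neq ny => /eqP.
    rewrite subr_eq0 eqr_norml => /andP[/orP[]/eqP ya _]; right; [left|right];
      by rewrite -ya addrC ?subrK// opprK addrCA subrr addr0.
  apply: cvg_near_cst; near=> n; congr EFin.
  rewrite indicE memNset ?mulr0// => /=; apply/negP; rewrite negb_or -!ltNge.
  by apply/andP; split; near: n; exact: (near_infty_natSinv_lt (PosNum _)).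
- exact: integrable_norm.
- by apply: aeW => y n _; rewrite lee_fin normrM normr_id ger0_norm// ler_piMr//
    indicE lern1 leq_b1.
move=> _ _.
rewrite integral0 => h; exact: (fine_cvg h).
Unshelve. all: by end_near. Qed.

Lemma continuous_avg (R : realType) (dx dy : R) (w : R * R -> R) :
  0 < dx -> 0 < dy -> loc_integrable1 w -> continuous (avg dx dy w).
Proof.
move=> dx0 dy0 lw x.
have dxy0 : 0 < dx * dy by exact: mulr_gt0.
have a0 : 0 <= dx / 2 by lra.
have b0 : 0 <= dy / 2 by lra.
pose a := dx / 2; pose b := dy / 2.
have [r xr] : exists r, box r r x.
  by have : setT x by []; rewrite -(bigcup_box R) => -[n _ xn]; exists n%:R.
(* The 1 leaves room for a center [x'] within distance 1 of [x], and a + b for the windows around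
   both. The frame is unbounded, so [w] must be truncated to this box to become integrable on the
   plane. *)
pose r' := r + 1 + a + b.
pose wr := w \_ (box r' r').
have iwr := loc_integrable_restrict r' r' lw.
have iW z := integrable_window z a0 b0 lw.
have iB x' : (lebesgue2 R).-integrable setT
    (EFin \o (fun y => window a b x y * w y - window a b x' y * w y)).
  exact: integrableB (iW x) (iW x').
have dist x' d : d <= 1 -> `|x.1 - x'.1| <= d -> `|x.2 - x'.2| <= d ->
   `|avg dx dy w x - avg dx dy w x'| <=
   (dx * dy)^-1 * \int[lebesgue2 R]_y (`|wr y| * \1_(frame a b d x) y).
  move=> d1 x1 x2.
  have x'r : box (r + 1) (r + 1) x'.
    move: xr => [/=]; rewrite !in_itv/= => /andP[? ?] /andP[? ?].
    move: x1 x2; rewrite !ler_norml => /andP[? ?] /andP[? ?].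
    by split; rewrite /= in_itv/=; apply/andP; split; lra.
  have xr1 : box (r + 1) (r + 1) x by apply: box_subset xr; rewrite lerDl.
  rewrite !avgE// -mulrBr normrM ger0_norm; last by rewrite invr_ge0 ltW.
  apply: ler_wpM2l; first by rewrite invr_ge0 ltW.
  rewrite -RintegralB//; [|exact: iW..].
  apply: le_trans (le_normr_Rintegral _ (iB _)) _ => //.
  apply: le_Rintegral => //.
  - exact: integrable_norm (iB _).
  - apply: (le_integrable measurableT _ _ iwr) => [|y _].
      apply/measurable_EFinP; apply: measurable_funM.
        by apply: measurableT_comp => //; apply/measurable_EFinP; case/integrableP: iwr.
      exact: measurable_indic (measurable_frame _ _ _ _).
    by rewrite /= lee_fin normrM normr_id ger0_norm// ler_piMr// indicE lern1 leq_b1.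
  move=> y _; rewrite -mulrBl normrM mulrC /wr patchE.
  case: ifPn => [_|]; first by apply: ler_wpM2l => //; exact: window_dist.
  by rewrite notin_setE => yr; rewrite (window_eq0 xr1 yr)// (window_eq0 x'r yr)//
    subrr normr0 mulr0 mul0r.
apply/cvgrPdist_lt => e e0.
have := frame_cvg0 a b x iwr.
move=> /cvgrPdist_lt /(_ (e * (dx * dy)) (mulr_gt0 e0 dxy0)).
move=> [N _ /(_ N (leqnn _))] /=; rewrite sub0r normrN => hN.
have : nbhs x (ball x (N.+1%:R^-1 : R)) by apply: nbhsx_ballx; rewrite invr_gt0.
apply: filterS.
move=> x' [x1 x2]; apply: le_lt_trans (dist x' N.+1%:R^-1 _ _ _) _.
- by rewrite invf_le1// ler1n.
- exact: ltW.
- exact: ltW.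
- by rewrite ltr_pdivrMl// mulrC; apply: le_lt_trans (ler_norm _) hN.
Qed.

(** The bound is uniform in x over the box. Applied to a difference of two times, it transfers
    continuity in L^1_loc from [w] to its average. *)
Lemma normr_avg_le (R : realType) (dx dy r : R) (w : R * R -> R) (x : R * R) :
  0 < dx -> 0 < dy -> loc_integrable1 w -> box r r x ->
  `|avg dx dy w x| <= (dx * dy)^-1 *
    \int[lebesgue2 R]_(y in box (r + dx / 2 + dy / 2) (r + dx / 2 + dy / 2)) `|w y|.
Proof.
move=> dx0 dy0 lw xr.
have a0 : 0 <= dx / 2 by lra.
have b0 : 0 <= dy / 2 by lra.
have c0 : 0 <= (dx * dy)^-1 by rewrite invr_ge0 mulr_ge0// ltW.
have iw := integrable_window x a0 b0 lw.
rewrite avgE// normrM ger0_norm//; apply: ler_wpM2l => //.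
rewrite [leRHS]Rintegral_mkcond.
apply: le_trans (le_normr_Rintegral _ iw) _ => //.
apply: le_Rintegral => //.
- exact: integrable_norm iw.
- set r1 := r + dx / 2 + dy / 2.
  have := integrable_norm (loc_integrable_restrict r1 r1 lw).
  by apply: eq_integrable => // y _; rewrite /= !patchE; case: ifP; rewrite ?normr0.
move=> y _; rewrite patchE; case: ifPn => [_|].
  by rewrite normrM ger0_norm ?window_ge0// ler_piMl// window_le1.
by rewrite notin_setE => yr; rewrite (window_eq0 xr yr)// mul0r normr0.
Qed.

Lemma sigma_finite_lebesgue2 (R : realType) : sigma_finite setT (lebesgue2 R).
Proof.
exists (fun n => box n%:R n%:R); first by rewrite bigcup_box.
by move=> n; split; [exact: measurable_box|exact: lebesgue2_box].
Qed.

(* The library's sigma-finiteness instance for products is shadowed by the one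
   for subprobabilities, so Fubini on pairs of points needs this repackaging. *)
Definition lebesgue2_sigma_finite (R : realType) :
    {sigma_finite_measure set (plane R) -> \bar R} :=
  HB.pack (lebesgue2 R)
    (Measure_isSigmaFinite.Build _ _ _ (lebesgue2 R) (@sigma_finite_lebesgue2 R)).

Lemma avg_adjoint (R : realType) (dx dy r : R) (w g : R * R -> R) :
  0 < dx -> 0 < dy -> loc_integrable1 w -> continuous g ->
  (forall x, ~ box r r x -> g x = 0) ->
  \int[lebesgue2 R]_x (avg dx dy w x * g x) =
  \int[lebesgue2 R]_x (w x * avg dx dy g x).
Proof.
move=> dx0 dy0 lw cg g0.
pose a := dx / 2; pose b := dy / 2.
have a0 : 0 <= a by rewrite /a; lra.
have b0 : 0 <= b by rewrite /b; lra.
have lg := continuous_loc_integrable cg.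
(* With [w] cut off, the kernel [F] is dominated by a product of two integrable functions, one of x
   and one of y. Since [g] lives in the box of radius r, the cut does not change the kernel
   ([winE]). *)
pose wr := w \_ (box (r + a + b) (r + a + b)).
have iwr : (lebesgue2 R).-integrable setT (EFin \o wr) := loc_integrable_restrict _ _ lw.
have ig : (lebesgue2 R).-integrable setT (EFin \o g).
  have := loc_integrable_restrict r r lg.
  apply: eq_integrable => // y _; rewrite /= !patchE; case: ifPn => //.
  by rewrite notin_setE => /g0 ->.
have mwr : measurable_fun [set: plane R] (wr : plane R -> measurableTypeR R).
  by apply/measurable_EFinP; case/integrableP : iwr.
have mg : measurable_fun [set: plane R] (g : plane R -> measurableTypeR R).
  exact: continuous_measurable_plane.
pose m := lebesgue2_sigma_finite R.
pose c := (dx * dy)^-1.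
have c0 : 0 <= c by rewrite invr_ge0 mulr_ge0// ltW.
pose F (p : plane R * plane R) := (c * window a b p.1 p.2 * wr p.2 * g p.1)%:E.
have mF : measurable_fun setT F.
  apply/measurable_EFinP; apply: measurable_funM.
    apply: measurable_funM.
      by apply: measurable_funM => //; exact: measurable_window2.
    exact: measurableT_comp mwr measurable_snd.
  exact: measurableT_comp mg measurable_fst.
have winE x y : window a b x y * wr y * g x = window a b x y * w y * g x.
  have [xr|xr] := pselect (box r r x); last by rewrite (g0 _ xr) !mulr0.
  rewrite /wr patchE; case: ifPn => //; rewrite notin_setE => yr.
  by rewrite (window_eq0 xr yr)// !mul0r.
have iF : (\int[lebesgue2 R]_x \int[lebesgue2 R]_y `|F (x, y)| < +oo)%E.
  pose I := (\int[lebesgue2 R]_y `|wr y|%:E)%E.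
  have I0 : (0 <= I)%E by exact: integral_ge0.
  have Ifin : I \is a fin_num by exact: (integrable_fin_num measurableT (integrable_norm iwr)).
  have mcg : measurable_fun setT (fun x : plane R => `|c * g x|%:E).
    by apply/measurable_EFinP; apply: measurableT_comp => //; exact: measurable_funM.
  apply: (@le_lt_trans _ _ (\int[lebesgue2 R]_x (`|c * g x|%:E * I))%E).
    have mabsF : measurable_fun setT (abse \o F) by exact: measurableT_comp mF.
    apply: ge0_le_integral.
    - exact: measurableT.
    - by move=> x _; exact: integral_ge0.
    - exact: (@measurable_fun_fubini_tonelli_F _ _ _ _ _ m (abse \o F) mabsF (fun=> abse_ge0 _)).
    - exact: emeasurable_funM.
    move=> x _; rewrite -ge0_integralZl//.
      apply: ge0_le_integral => //.
      + exact: measurableT_comp (measurableT_comp mF (pair1_measurable x)).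
      + by apply: emeasurable_funM => //; apply/measurable_EFinP; exact: measurableT_comp.
      move=> y _; rewrite /F /= -EFinM lee_fin !normrM mulrAC.
      rewrite ler_wpM2r// mulrAC ger0_norm// (ger0_norm (window_ge0 _ _ _ _)).
      by rewrite ler_piMr ?window_le1// mulr_ge0.
    by apply/measurable_EFinP; exact: measurableT_comp.
  rewrite ge0_integralZr//; rewrite muleC lte_mul_pinfty//.
  exact: (integrable_lty measurableT (integrable_norm (integrableZl measurableT c ig))).
have inner1 x : (\int[lebesgue2 R]_y F (x, y) = (avg dx dy w x * g x)%:E)%E.
  have iw := integrable_window x a0 b0 lw.
  rewrite avgE// (_ : c * _ * g x = c * g x * \int[lebesgue2 R]_y (window a b x y * w y)); last first.
    by rewrite mulrAC.
  rewrite -RintegralZl// /Rintegral fineK.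
    by apply: eq_integral => y _; congr EFin; rewrite /= -!mulrA; congr (c * _);
      rewrite mulrA winE mulrC mulrA.
  apply: integrable_fin_num => //.
  exact: (integrableZl measurableT (c * g x) iw).
(* Integrating over x first, [windowC] exchanges the roles of the two points and produces the
   average of [g] centered at y. *)
have inner2 y : (\int[lebesgue2 R]_x F (x, y) = (w y * avg dx dy g y)%:E)%E.
  have iw := integrable_window y a0 b0 lg.
  rewrite avgE// mulrA.
  rewrite -RintegralZl// /Rintegral fineK.
    apply: eq_integral => x _; congr EFin; rewrite /= -/a -/b -/c.
    transitivity (c * (window a b x y * wr y * g x)); first by ring.
    by rewrite winE (windowC _ _ x); ring.
  apply: integrable_fin_num => //.
  exact: (integrableZl measurableT _ iw).
rewrite /Rintegral; congr fine.
under eq_integral do rewrite -inner1.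
under [RHS]eq_integral do rewrite -inner2.
have : (m \x m)%E.-integrable setT F by exact/integrable12ltyP.
exact: Fubini.
Qed.

(** * Averages of test functions *)

(** Joint continuity gives the estimate near each pair (s, p); the near-covering form of compactness
    makes the neighborhood of p independent of s in [K]. *)
Lemma near_dist_compact (R : realType) (phi : R * (R * R) -> R)
    (K : set (R * R)) (p : R * (R * R)) (e : R) :
  continuous phi -> compact K -> 0 < e ->
  \forall p' \near p, forall s, K s ->
    `|phi (p' + (0, s)) - phi (p + (0, s))| < e.
Proof.
move=> cphi /compact_near_coveringP cK e0.
pose P (p' : R * (R * R)) (s : R * R) : Prop :=
  `|phi (p' + (0, s)) - phi (p + (0, s))| < e.
suff : forall s, K s -> \forall s' \near s & p' \near p, P p' s'.
  exact: (cK _ (nbhs p) P).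
move=> s Ks.
have c0 : (fun z : (R * R) * (R * (R * R)) => (0 : R, z.1)) z
    @[z --> (s, p)] --> (0 : R, s).
  apply: (@cvg_pair _ _ _ _ (nbhs (0 : R)) (nbhs s)); first exact: cvg_cst.
  exact: cvg_fst.
have c1 : z.2 + (0, z.1) @[z --> (s, p)] --> p + (0, s).
  by apply: cvgD c0; exact: cvg_snd.
have c2 : p + (0, z.1) @[z --> (s, p)] --> p + (0, s).
  by apply: cvgD c0; exact: cvg_cst.
have /cvgrPdist_lt /(_ e e0) : phi (z.2 + (0, z.1)) - phi (p + (0, z.1))
    @[z --> (s, p)] --> phi (p + (0, s)) - phi (p + (0, s)).
  by apply: cvgB; [exact: cvg_comp c1 (cphi _)|exact: cvg_comp c2 (cphi _)].
by rewrite subrr; apply: filterS => z /=; rewrite sub0r normrN.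
Qed.

Lemma fine_lebesgue2_box (R : realType) (dx dy : R) :
  0 < dx -> 0 < dy -> fine (lebesgue2 R (box (dx / 2) (dy / 2))) = dx * dy.
Proof.
move=> dx0 dy0.
rewrite product_measure1E; [|exact: measurable_itv|exact: measurable_itv].
have h (d : R) : 0 < d -> (- (d / 2) < d / 2) by move=> d0; lra.
rewrite /= !lebesgue_measure_itv/= !lte_fin !h//=. by congr (_ * _); lra.
Qed.

(** The base points may differ, so averages over two different cells are compared offset by offset;
    the mean of the constant e is e because the cell has area dx * dy. *)
Lemma avg_dist (R : realType) (dx dy e : R) (f g : R * R -> R) (x y : R * R) :
  0 < dx -> 0 < dy -> continuous f -> continuous g ->
  (forall s, box (dx / 2) (dy / 2) s -> `|f (x + s) - g (y + s)| <= e) ->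
  `|avg dx dy f x - avg dx dy g y| <= e.
Proof.
move=> dx0 dy0 cf cg fg.
have mB := measurable_box (dx / 2) (dy / 2).
have iB (k : R * R -> R) z : continuous k -> (lebesgue2 R).-integrable
    (box (dx / 2) (dy / 2)) (EFin \o (fun s => k (z + s))).
  move=> ck; apply: loc_integrable_box; apply: continuous_loc_integrable => s.
  apply: continuous_comp; last exact: ck.
  by apply: cvgD; [exact: cvg_cst|exact: cvg_id].
have dxy0 : 0 < dx * dy by exact: mulr_gt0.
rewrite -mulrBr normrM gtr0_norm ?invr_gt0// ler_pdivrMl//.
rewrite -RintegralB//; [|exact: iB..].
have iD := integrableB mB (iB _ x cf) (iB _ y cg).
apply: le_trans (le_normr_Rintegral mB iD) _.
have <- : \int[lebesgue2 R]_(s in box (dx / 2) (dy / 2)) e = dx * dy * e.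
  by rewrite Rintegral_cst// fine_lebesgue2_box// mulrC.
apply: le_Rintegral => //; first exact: integrable_norm iD.
apply: loc_integrable_box; apply: continuous_loc_integrable => s; exact: cvg_cst.
Qed.

(** The form c * f + g serves differences (c = -1), induction on finite sums, and the first-order
    expansion of a test function (c = h). *)
Lemma loc_integrable_lin (R : realType) (c : R) (f g : R * R -> R) :
  loc_integrable1 f -> loc_integrable1 g -> loc_integrable1 (fun y => c * f y + g y).
Proof.
move=> lf lg r; have mr := measurable_box r r.
have := integrableD mr (integrableZl mr c (lf r)) (lg r).
by apply: eq_integrable.
Qed.

Lemma avg_lin (R : realType) (dx dy c : R) (f g : R * R -> R) (x : R * R) :
  0 < dx -> 0 < dy -> loc_integrable1 f -> loc_integrable1 g ->
  avg dx dy (fun y => c * f y + g y) x = c * avg dx dy f x + avg dx dy g x.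
Proof.
move=> dx0 dy0 lf lg.
have a0 : 0 <= dx / 2 by lra.
have b0 : 0 <= dy / 2 by lra.
rewrite !avgE//; last exact: loc_integrable_lin.
have iW f' := @integrable_window _ _ _ x f' a0 b0.
rewrite mulrCA -mulrDr -[c * _]RintegralZl//; last exact: iW.
rewrite -RintegralD//; [|exact: (integrableZl measurableT c (iW _ lf))|exact: iW].
by congr (_ * _); apply: eq_Rintegral => y _; ring.
Qed.

Lemma loc_integrable_sum (R : realType) (I : Type) (s : seq I) (c : I -> R)
    (f : I -> R * R -> R) :
  (forall k, loc_integrable1 (f k)) ->
  loc_integrable1 (fun y => \sum_(k <- s) c k * f k y).
Proof.
move=> lf; elim: s => [|k s IHs].
  under eq_fun do rewrite big_nil.
  by apply: continuous_loc_integrable => y; exact: cvg_cst.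
by under eq_fun do rewrite big_cons; exact: loc_integrable_lin.
Qed.

Lemma avg_sum (R : realType) (dx dy : R) (I : Type) (s : seq I) (c : I -> R)
    (f : I -> R * R -> R) (x : R * R) :
  0 < dx -> 0 < dy -> (forall k, loc_integrable1 (f k)) ->
  avg dx dy (fun y => \sum_(k <- s) c k * f k y) x =
  \sum_(k <- s) c k * avg dx dy (f k) x.
Proof.
move=> dx0 dy0 lf; elim: s => [|k s IHs].
  rewrite big_nil /avg; under eq_Rintegral do rewrite big_nil.
  by rewrite Rintegral_cst ?mul0r ?mulr0//; exact: measurable_box.
under eq_fun do rewrite big_cons.
by rewrite avg_lin//; [rewrite IHs big_cons|exact: loc_integrable_sum].
Qed.

(** The average acts in space only, at frozen time, so it cannot push a support towards t = 0. *)
Definition tavg (R : realType) (dx dy : R) (phi : R * (R * R) -> R)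
  (p : R * (R * R)) : R := avg dx dy (fun x => phi (p.1, x)) p.2.

Lemma continuous_slice (R : realType) (phi : R * (R * R) -> R) (t : R) :
  continuous phi -> continuous (fun x => phi (t, x)).
Proof.
move=> cphi x; apply: (@cvg_comp _ _ _ (fun x => (t, x)) phi); last exact: cphi.
by apply: (@cvg_pair _ _ _ _ (nbhs t) (nbhs x)); [exact: cvg_cst|exact: cvg_id].
Qed.

Lemma pair_shift (R : realType) (p : R * (R * R)) (s : R * R) :
  (p.1, p.2 + s) = p + (0, s).
Proof. by case: p => t x; congr pair; rewrite /= addr0. Qed.

Lemma continuous_tavg (R : realType) (dx dy : R) (phi : R * (R * R) -> R) :
  0 < dx -> 0 < dy -> continuous phi -> continuous (tavg dx dy phi).
Proof.
move=> dx0 dy0 cphi p; apply/cvgrPdist_le => e e0.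
near=> p'.
rewrite /tavg; apply: avg_dist => //; try exact: continuous_slice.
move=> s Bs; rewrite !pair_shift distrC ltW//; move: s Bs; near: p'.
exact: near_dist_compact (@compact_box R (dx / 2) (dy / 2)) e0.
Unshelve. all: by end_near. Qed.

(** Only |c| <= |h| is recorded, which covers both signs of h and is all that a limit h -> 0
    requires. *)
Lemma MVT_line (R : realType) (phi : R * (R * R) -> R) (q v : R * (R * R)) (h : R) :
  (forall p, derivable phi p v) ->
  exists2 c, `|c| <= `|h| & phi (q + h *: v) - phi q = h * 'D_v phi (q + c *: v).
Proof.
move=> dphi.
pose g (t : R) := phi (q + t *: v).
have dg (t : R) : is_derive t (1 : R) g ('D_v phi (q + t *: v)).
  (* The difference quotient of g at t is literally that of phi at q + t v in direction v. *)
  have E : (fun k : R => k^-1 *: ((g \o shift t) (k *: 1) - g t)) =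
      (fun k => k^-1 *: ((phi \o shift (q + t *: v)) (k *: v) - phi (q + t *: v))).
    apply/funext => k; rewrite /g /=; congr (_ *: (phi _ - _)).
    by rewrite [k *: 1]mulr1 scalerDl addrCA.
  split; first by rewrite /derivable E; exact: dphi.
  by rewrite /derive E.
have cg : continuous g.
  by move=> t; apply: differentiable_continuous; apply/derivable1_diffP; have [] := dg t.
have [h0|h0] := leP 0 h.
  have [c] := MVT_segment h0 (fun t _ => dg t) (continuous_subspaceT cg).
  rewrite in_itv/= => /andP[c0 ch]; rewrite subr0 mulrC /g scale0r addr0 => E.
  by exists c => //; rewrite !ger0_norm.
have [c] := MVT_segment (ltW h0) (fun t _ => dg t) (continuous_subspaceT cg).
rewrite in_itv/= => /andP[ch c0]; rewrite sub0r /g scale0r addr0 => E.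
exists c; first by rewrite !ler0_norm ?lerN2// ltW.
by rewrite -opprB E mulrN opprK mulrC.
Qed.

(** By [MVT_line] the first-order remainder at each offset s is h times the variation of ['D_v phi]
    between two points at distance at most |h| |v|; this is small uniformly over the compact cell,
    hence so is its average. *)
Lemma derive_tavg (R : realType) (dx dy : R) (phi : R * (R * R) -> R)
    (p v : R * (R * R)) :
  0 < dx -> 0 < dy -> continuous phi -> (forall q, derivable phi q v) ->
  continuous ('D_v phi) ->
  is_derive p v (tavg dx dy phi) (tavg dx dy ('D_v phi) p).
Proof.
move=> dx0 dy0 cphi dphi cD.
suff lim : h^-1 *: ((tavg dx dy phi \o shift p) (h *: v) - tavg dx dy phi p)
    @[h --> 0^'] --> tavg dx dy ('D_v phi) p.
  split; first by apply/cvg_ex; exists (tavg dx dy ('D_v phi) p).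
  exact: cvg_lim lim.
apply/cvgrPdist_le => e e0.
have line0 : (p + k *: v) @[k --> (0 : R)] --> p.
  rewrite -[X in _ --> X]addr0 -(scale0r v).
  by apply: cvgD; [exact: cvg_cst|apply: cvgZr_tmp; exact: cvg_id].
have near_p := near_dist_compact p cD (@compact_box R (dx / 2) (dy / 2)) e0.
have /nbhs_norm0P[d /= d0 hd] := line0 _ near_p.
near=> h.
have h0 : h != 0 by near: h; exact: nbhs_dnbhs_neq.
have hsmall : `|h| < d by near: h; exact: dnbhs0_lt.
rewrite distrC -[tavg _ _ ('D_v phi) p](mulKf h0) -[_ *: _]/(_ * _) -mulrBr normrM.
rewrite normfV ler_pdivrMl ?normr_gt0//.
rewrite -addrA -opprD [X in _ - X]addrC.
have lD := continuous_loc_integrable (continuous_slice (t := p.1) cD).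
have lp := continuous_loc_integrable (continuous_slice (t := p.1) cphi).
(* Merging h times the averaged derivative with the average of phi leaves just two averages to
   compare pointwise. *)
rewrite /tavg/= -avg_lin//.
apply: avg_dist => //.
- exact: continuous_slice.
- move=> y.
  have s1 : phi (p.1, x) @[x --> y] --> phi (p.1, y)
    by exact: (@continuous_slice R phi p.1 cphi y).
  have s2 : 'D_v phi (p.1, x) @[x --> y] --> 'D_v phi (p.1, y)
    by exact: (@continuous_slice R ('D_v phi) p.1 cD y).
  by apply: cvgD s1; apply: cvgM s2; exact: cvg_cst.
move=> s Bs.
have [c ch] := MVT_line (p + (0, s)) h dphi.
rewrite -[(_ + p.1, _)]/((h *: v + p).1, (h *: v + p).2 + s).
rewrite !pair_shift (_ : h *: v + p + (0, s) = p + (0, s) + h *: v); last first.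
  by rewrite -addrA addrC.
move=> /eqP; rewrite subr_eq => /eqP ->.
rewrite [X in `|X|](_ : _ = h * ('D_v phi (p + (0, s) + c *: v) - 'D_v phi (p + (0, s)))).
  rewrite normrM ler_wpM2l// ltW// addrAC.
  by apply: hd Bs => /=; exact: le_lt_trans ch hsmall.
by ring.
Unshelve. all: by end_near. Qed.

(** Off the support, whose complement is open, phi vanishes locally and so does its derivative. The
    support is bounded in space-time, hence one spatial radius serves all times. *)
Lemma test_function_derive (R : realType) (phi : R * (R * R) -> R)
    (v : R * (R * R)) : test_function phi ->
  exists r, forall t x, ~ box r r x -> 'D_v phi (t, x) = 0.
Proof.
move=> [_ _ [K [cK _ K0]]].
have [M [_ HM]] := compact_bounded cK.
pose r := `|M| + 1.
have Kr p : K p -> `|p| <= r.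
  by move=> Kp; apply: HM => //; rewrite /r ltr_pwDr// ler_norm.
exists r => t x xr.
have nK : ~ K (t, x).
  move=> /Kr; rewrite !prod_normE/= !ge_max => /andP[_ /andP[x1 x2]].
  by apply: xr; split; rewrite /= in_itv/= -ler_norml.
rewrite (@near_eq_derive _ _ _ phi (cst 0)) ?derive_cst//.
have oK : open (~` K) by exact: closed_openC (compact_closed (@norm_hausdorff _ _) cK).
have : nbhs (t, x) (~` K) by exact: open_nbhs_nbhs.
by apply: filterS => p /K0.
Qed.

Lemma test_function_tavg (R : realType) (dx dy : R) (phi : R * (R * R) -> R) :
  0 < dx -> 0 < dy -> test_function phi -> test_function (tavg dx dy phi).
Proof.
move=> dx0 dy0 [cphi dphi [K [cK Kpos K0]]]; split.
- exact: continuous_tavg.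
- move=> v ve; have [dv cv] := dphi v ve.
  have D p := derive_tavg p dx0 dy0 cphi dv cv.
  split; first by move=> p; have [] := D p.
  rewrite (_ : 'D_v (tavg dx dy phi) = tavg dx dy ('D_v phi)).
    exact: continuous_tavg.
  by apply/funext => p; have [_] := D p.
(* The new support is the old one minus all offsets of the cell, a continuous image of a compact
   product; time coordinates are unchanged. *)
exists ((fun q : (R * (R * R)) * (R * R) => q.1 - (0, q.2)) @`
  (K `*` box (dx / 2) (dy / 2))); split.
- apply: continuous_compact; last by apply: compact_setX => //; exact: compact_box.
  apply: continuous_subspaceT => q; apply: cvgB; first exact: cvg_fst.
  by apply: (@cvg_pair _ _ _ _ (nbhs (0 : R)) (nbhs q.2)); [exact: cvg_cst|exact: cvg_snd].
- by move=> _ [[p s] [Kp _] <-]; rewrite /= subr0; exact: Kpos.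
move=> p pK; rewrite /tavg /avg.
rewrite (@eq_Rintegral _ _ _ _ _ (cst 0)) ?Rintegral_cst ?mul0r ?mulr0//.
  exact: measurable_box.
move=> s /set_mem Bs; rewrite pair_shift K0// => Kps; apply: pK.
by exists (p + (0, s), s) => //=; rewrite addrK.
Qed.

(** * Weak solutions *)

Lemma ae_lebesgue2S (R : realType) (P Q : plane R -> Prop) :
  (forall x, P x -> Q x) ->
  (\forall x \ae lebesgue2 R, P x) -> \forall x \ae lebesgue2 R, Q x.
Proof. exact: (@filterS _ _ (ae_filter_ringOfSetsType (lebesgue2 R))). Qed.

Lemma ae_lebesgue2S2 (R : realType) (P Q S : plane R -> Prop) :
  (forall x, P x -> Q x -> S x) ->
  (\forall x \ae lebesgue2 R, P x) -> (\forall x \ae lebesgue2 R, Q x) ->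
  \forall x \ae lebesgue2 R, S x.
Proof. exact: (@filterS2 _ _ (ae_filter_ringOfSetsType (lebesgue2 R))). Qed.

Lemma avg_ae (R : realType) (dx dy : R) (f g : R * R -> R) (x : R * R) :
  loc_integrable1 f -> loc_integrable1 g -> f = g %[ae lebesgue2 R] ->
  avg dx dy f x = avg dx dy g x.
Proof.
move=> lf lg fg; rewrite !avgE//; congr (_ * _); rewrite /Rintegral; congr fine.
have mw (h : R * R -> R) : loc_integrable1 h -> measurable_fun [set: plane R]
    (fun y => (window (dx / 2) (dy / 2) x y * h y)%:E).
  move=> lh; apply/measurable_EFinP; apply: measurable_funM.
    exact: measurable_window.
  exact: loc_integrable_measurable.
apply: ae_eq_integral => //; [exact: mw..|].
by move: fg; apply: ae_lebesgue2S => y fgy _; rewrite fgy.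
Qed.

(** If f and g differed at x they would differ on a ball around x, which is a product of two
    intervals and has positive measure. *)
Lemma continuous_ae_eq (R : realType) (f g : R * R -> R) :
  continuous f -> continuous g -> f = g %[ae lebesgue2 R] -> f = g.
Proof.
move=> cf cg [N [mN N0 fgN]]; apply/funext => x; apply: contrapT => fgx.
have fg0 : f x - g x != 0 by rewrite subr_eq0; apply/eqP.
have cfg : f y - g y @[y --> x] --> f x - g x by apply: cvgB; [exact: cf|exact: cg].
have /nbhs_ballP[e /= e0 he] : nbhs x [set y | f y - g y != 0].
  exact: cvgr_neq0 cfg fg0.
have sub : (ball x.1 e `*` ball x.2 e) `<=` N.
  move=> y [y1 y2]; apply: fgN => /= /(_ I) fgy.
  have /he : ball x e y by split.
  by rewrite /= fgy subrr eqxx.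
have mball (z : R) : measurable (ball z e : set (measurableTypeR R)).
  exact: measurable_ball.
have : (lebesgue2 R (ball x.1 e `*` ball x.2 e) <= 0)%E.
  by rewrite -N0 le_measure ?inE//; exact: measurableX.
have m2 (z : R) := lebesgue_measure_ball z (ltW e0).
rewrite product_measure1E//= !m2 -EFinM lee_fin.
by rewrite leNgt mulr_gt0// mulrn_wgt0.
Qed.

Lemma continuous_col (R : realType) (n : nat) (f : R * R -> 'cV[R]_n) :
  continuous f <-> forall i, continuous (fun x => f x i 0).
Proof.
split=> [cf i x|cf x U].
  exact: (@cvg_comp _ _ _ f (fun M : 'cV[R]_n => M i 0) _ _ _ (cf x) (@coord_continuous _ _ _ i 0 _)).
move=> [P xP PU].
have near_i (i : 'I_n) : nbhs x [set y | P i 0 (f y i 0)] by apply: cf; exact: xP.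
have near_all : nbhs x [set y | forall i : 'I_n, P i 0 (f y i 0)].
  exact: (@filter_forall _ _ (fun i => [set y | P i 0 (f y i 0)]) (nbhs x)).
have sub : [set y | forall i : 'I_n, P i 0 (f y i 0)] `<=` f @^-1` U.
  by move=> y Py; apply: PU => i j; rewrite (ord1 j); exact: Py.
exact: (@filterS _ (nbhs x) _ _ _ sub).
Qed.

Lemma sliding_averageE (R : realType) (n : nat) (dx dy : R)
    (q : R * R -> 'cV[R]_n) (x : R * R) (i : 'I_n) :
  sliding_average dx dy q x i 0 = avg dx dy (fun y => q y i 0) x.
Proof. by rewrite mxE. Qed.

Lemma loc_integrable_coord (R : realType) (n : nat) (q : R * R -> 'cV[R]_n) (i : 'I_n) :
  loc_integrable q -> loc_integrable1 (fun x => q x i 0).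
Proof. by move=> lq r; exact: lq. Qed.

Lemma continuous_sliding_average (R : realType) (n : nat) (dx dy : R)
    (q : R * R -> 'cV[R]_n) : 0 < dx -> 0 < dy -> loc_integrable q ->
  continuous (sliding_average dx dy q).
Proof.
move=> dx0 dy0 lq; apply/continuous_col => i.
under eq_fun do rewrite sliding_averageE.
exact/continuous_avg/loc_integrable_coord.
Qed.

Lemma sliding_average_ae (R : realType) (n : nat) (dx dy : R)
    (f g : R * R -> 'cV[R]_n) : loc_integrable f -> loc_integrable g ->
  f = g %[ae lebesgue2 R] -> sliding_average dx dy f = sliding_average dx dy g.
Proof.
move=> lf lg fg; apply/funext => x; apply/colP => i; rewrite !sliding_averageE.
apply: avg_ae; [exact: loc_integrable_coord..|].
by move: fg; apply: ae_lebesgue2S => y fgy _; rewrite fgy.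
Qed.

Lemma continuous_loc_integrable_col (R : realType) (n : nat) (f : R * R -> 'cV[R]_n) :
  continuous f -> loc_integrable f.
Proof.
by move=> /continuous_col cf i; exact: continuous_loc_integrable (cf i).
Qed.

Lemma loc_integrable_mulmx (R : realType) (n : nat) (J : 'M[R]_n)
    (q : R * R -> 'cV[R]_n) (i : 'I_n) :
  loc_integrable q -> loc_integrable1 (fun x => (J *m q x) i 0).
Proof.
move=> lq; under eq_fun do rewrite mxE.
by apply: loc_integrable_sum => k; exact: loc_integrable_coord.
Qed.

Lemma avg_mulmx (R : realType) (n : nat) (dx dy : R) (J : 'M[R]_n)
    (q : R * R -> 'cV[R]_n) (i : 'I_n) (x : R * R) :
  0 < dx -> 0 < dy -> loc_integrable q ->
  (J *m sliding_average dx dy q x) i 0 = avg dx dy (fun y => (J *m q y) i 0) x.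
Proof.
move=> dx0 dy0 lq; under [in RHS]eq_fun do rewrite mxE.
rewrite avg_sum//.
by rewrite mxE; apply: eq_bigr => k _; rewrite sliding_averageE.
Qed.

Lemma avg_cvg0 (R : realType) (dx dy r : R) (w : R -> R * R -> R) (t0 : R) :
  0 < dx -> 0 < dy -> 0 <= t0 -> (forall t, 0 <= t -> loc_integrable1 (w t)) ->
  (forall r : R, (\int[lebesgue2 R]_(x in box r r) `|w t x - w t0 x|)
     @[t --> within `[0, +oo[ (nbhs t0)] --> (0 : R)) ->
  (\int[lebesgue2 R]_(x in box r r) `|avg dx dy (w t) x - avg dx dy (w t0) x|)
     @[t --> within `[0, +oo[ (nbhs t0)] --> (0 : R).
Proof.
move=> dx0 dy0 t00 lw wc.
pose r' := r + dx / 2 + dy / 2.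
(* Integrating the uniform bound of [normr_avg_le] over the box contributes its area. *)
pose C := fine (lebesgue2 R (box r r)) * (dx * dy)^-1.
have bound t : 0 <= t ->
    \int[lebesgue2 R]_(x in box r r) `|avg dx dy (w t) x - avg dx dy (w t0) x| <=
    C * \int[lebesgue2 R]_(x in box r' r') `|w t x - w t0 x|.
  move=> t_ge0.
  have lwt := lw _ t_ge0; have lw0 := lw _ t00.
  pose d := fun y => -1 * w t0 y + w t y.
  have ld : loc_integrable1 d by exact: loc_integrable_lin.
  have dE y : w t y - w t0 y = d y by rewrite /d mulN1r addrC.
  have aE x : avg dx dy (w t) x - avg dx dy (w t0) x = avg dx dy d x.
    by rewrite avg_lin// mulN1r addrC.
  under eq_Rintegral do rewrite aE.
  under [X in C * X]eq_Rintegral do rewrite dE.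
  have lad := continuous_loc_integrable (continuous_avg dx0 dy0 ld).
  rewrite /C -mulrA mulrC -Rintegral_cst; last exact: measurable_box.
  apply: le_Rintegral; first exact: measurable_box.
  - exact: integrable_norm (lad r).
  - by apply: continuous_loc_integrable => y; exact: cvg_cst.
  by move=> x xr; exact: normr_avg_le.
apply: (@squeeze_cvgr _ _ _ _ (cst 0) (fun t => C * \int[lebesgue2 R]_(x in box r' r') `|w t x - w t0 x|)).
- have bd t : `[0, +oo[%classic t ->
      0 <= \int[lebesgue2 R]_(x in box r r) `|avg dx dy (w t) x - avg dx dy (w t0) x|
      <= C * \int[lebesgue2 R]_(x in box r' r') `|w t x - w t0 x|.
    by rewrite /= in_itv/= andbT => t_ge0; rewrite Rintegral_ge0//= bound.
  exact: (@filterE _ (nbhs t0) _ _ bd).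
- exact: cvg_cst.
have W := wc r'.
by rewrite -[X in _ --> X](mulr0 C); apply: cvgM W; exact: cvg_cst.
Qed.

Lemma Rintegral_add3 (R : realType) (f g h : R * R -> R) :
  (lebesgue2 R).-integrable setT (EFin \o f) ->
  (lebesgue2 R).-integrable setT (EFin \o g) ->
  (lebesgue2 R).-integrable setT (EFin \o h) ->
  \int[lebesgue2 R]_x (f x + g x + h x) = \int[lebesgue2 R]_x f x +
    \int[lebesgue2 R]_x g x + \int[lebesgue2 R]_x h x.
Proof.
move=> If Ig Ih; rewrite RintegralD//; first by rewrite RintegralD.
by have := integrableD measurableT If Ig; exact: eq_integrable.
Qed.

(** Constant matrices commute with averaging by linearity, so each of the three terms has the form
    covered by [avg_adjoint] at fixed t. Splitting the integral requires each term to be integrable,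
    which compact support in space ensures. *)
Lemma weak_form_avg (R : realType) (n : nat) (Jx Jy : 'M[R]_n) (dx dy t : R)
    (q : R * R -> 'cV[R]_n) (phi : R * (R * R) -> R) (i : 'I_n) :
  0 < dx -> 0 < dy -> loc_integrable q -> test_function phi ->
  \int[lebesgue2 R]_x
    (sliding_average dx dy q x i 0 * 'D_(e_t R) phi (t, x)
     + (Jx *m sliding_average dx dy q x) i 0 * 'D_(e_x R) phi (t, x)
     + (Jy *m sliding_average dx dy q x) i 0 * 'D_(e_y R) phi (t, x)) =
  \int[lebesgue2 R]_x
    (q x i 0 * 'D_(e_t R) (tavg dx dy phi) (t, x)
     + (Jx *m q x) i 0 * 'D_(e_x R) (tavg dx dy phi) (t, x)
     + (Jy *m q x) i 0 * 'D_(e_y R) (tavg dx dy phi) (t, x)).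
Proof.
move=> dx0 dy0 lq tphi.
have [cphi dphi _] := tphi.
have [_ dPhi _] := test_function_tavg dx0 dy0 tphi.
have term (w : R * R -> R) v : v \in [:: e_t R; e_x R; e_y R] -> loc_integrable1 w ->
  [/\ (lebesgue2 R).-integrable setT
         (EFin \o (fun x => avg dx dy w x * 'D_v phi (t, x))),
      (lebesgue2 R).-integrable setT
         (EFin \o (fun x => w x * 'D_v (tavg dx dy phi) (t, x)))
    & \int[lebesgue2 R]_x (avg dx dy w x * 'D_v phi (t, x)) =
      \int[lebesgue2 R]_x (w x * 'D_v (tavg dx dy phi) (t, x))].
  move=> vin lw.
  have [dv cv] := dphi v vin; have [_ cV] := dPhi v vin.
  have [r hr] := test_function_derive v tphi.
  have [r' hr'] := test_function_derive v (test_function_tavg dx0 dy0 tphi).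
  have cD := continuous_slice (t := t) cv.
  split.
  - apply: (loc_integrableM _ cD (hr t)).
    exact: continuous_loc_integrable (continuous_avg dx0 dy0 lw).
  - exact: (loc_integrableM lw (continuous_slice (t := t) cV) (hr' t)).
  rewrite (avg_adjoint dx0 dy0 lw cD (hr t)); apply: eq_Rintegral => x _.
  by have [_ ->] := derive_tavg (t, x) dx0 dy0 cphi dv cv.
have [a1 b1 e1] := term _ (e_t R) (mem_head _ _) (loc_integrable_coord i lq).
have vx : e_x R \in [:: e_t R; e_x R; e_y R] by rewrite !inE eqxx orbT.
have vy : e_y R \in [:: e_t R; e_x R; e_y R] by rewrite !inE eqxx !orbT.
have [a2 b2 e2] := term _ _ vx (loc_integrable_mulmx Jx i lq).
have [a3 b3 e3] := term _ _ vy (loc_integrable_mulmx Jy i lq).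
have e := congr2 +%R (congr2 +%R e1 e2) e3.
apply: etrans (etrans (Rintegral_add3 a1 a2 a3) (etrans e (esym (Rintegral_add3 b1 b2 b3)))).
apply: eq_Rintegral => x _.
have mE J := avg_mulmx J i x dx0 dy0 lq.
by rewrite (mE Jx) (mE Jy) (sliding_averageE dx dy q x i).
Qed.

Lemma weak_solution_avg (R : realType) (n : nat) (Jx Jy : 'M[R]_n) (dx dy : R)
    (q0 : R * R -> 'cV[R]_n) (q : R -> R * R -> 'cV[R]_n) :
  0 < dx -> 0 < dy -> loc_integrable q0 -> weak_solution Jx Jy q0 q ->
  weak_solution Jx Jy (sliding_average dx dy q0)
    (fun t => sliding_average dx dy (q t)).
Proof.
move=> dx0 dy0 lq0 [lq cq q00 wq]; split.
- move=> t t0; apply: continuous_loc_integrable_col.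
  exact/continuous_sliding_average/lq.
- move=> t0 r i t00.
  under eq_fun do under eq_Rintegral do rewrite !sliding_averageE.
  apply: (@avg_cvg0 R dx dy r (fun t x => q t x i 0)) => // [t tge0|r'].
    exact/loc_integrable_coord/lq.
  exact: cq.
- by rewrite (sliding_average_ae dx dy (lq 0 (lexx 0)) lq0 q00); apply: aeW.
(* The averaged solution tested against phi is the original solution tested against
   [tavg dx dy phi]. *)
move=> phi i tphi; apply: etrans (wq _ i (test_function_tavg dx0 dy0 tphi)).
apply: eq_Rintegral => t; rewrite inE/= in_itv/= andbT => t0.
exact: weak_form_avg (lq t (ltW t0)) tphi.
Qed.

Lemma weak_solution_evolution (R : realType) (n : nat) (Jx Jy : 'M[R]_n)
    (q0 : R * R -> 'cV[R]_n) : well_posed Jx Jy q0 ->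
  exists2 q, weak_solution Jx Jy q0 q &
    forall t, evolution Jx Jy t q0 =
      xget (q t) [set f | continuous f /\ f = q t %[ae lebesgue2 R]].
Proof.
move=> [_ ex _]; eexists; last by [].
exact: (xgetPex (fun _ _ => 0) ex).
Qed.

Theorem lemma4p1 (R : realType) (n : nat) (Jx Jy : 'M[R]_n)
  (hJ : hyperbolic Jx Jy)
  (dx dy dt : R) (dx0 : 0 < dx) (dy0 : 0 < dy) (dt0 : 0 < dt)
  (c : R * R) (qd : int -> int -> 'cV[R]_n) (qrecon : R * R -> 'cV[R]_n)
  (hrecon : reconstruction dx dy c qd qrecon)
  (hq : well_posed Jx Jy qrecon)
  (hAq : well_posed Jx Jy (sliding_average dx dy qrecon)) :
  forall i j : int,
    sliding_average dx dy (evolution Jx Jy dt qrecon) (cell_center dx dy c i j)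
    = evolution Jx Jy dt (sliding_average dx dy qrecon)
        (cell_center dx dy c i j).
Proof.
(* The equality is proved between functions on the whole plane. *)
move=> i j; congr (_ (cell_center _ _ _ _ _)).
have [q wq ->] := weak_solution_evolution hq.
have [p wp ->] := weak_solution_evolution hAq.
have [lq0 _ _] := hq; have [_ _ uniq] := hAq.
have [lq _ _ _] := wq.
have ldt := lq dt (ltW dt0).
have cA := continuous_sliding_average dx0 dy0 ldt.
have Ap := uniq _ _ (weak_solution_avg dx0 dy0 lq0 wq) wp dt (ltW dt0).
transitivity (sliding_average dx dy (q dt)).
  (* Either [evolution] selected a continuous representative, which has the same averages as [q dt],
     or it returned [q dt] itself. *)
  case: xgetP => [f _ [cf fq]|_] //.
  by apply: sliding_average_ae => //; exact: continuous_loc_integrable_col.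
(* The average of [q dt] is continuous and a.e. equal to [p dt], so it is an admissible
   representative; any other one agrees with it everywhere by continuity. *)
apply/esym/xget_unique => // f [cf fp].
apply/funext => x; apply/colP => k.
have E : (fun y => f y k 0) = (fun y => sliding_average dx dy (q dt) y k 0).
  apply: continuous_ae_eq.
  - by move/continuous_col: cf; exact.
  - by move/continuous_col: cA; exact.
  by apply: ae_lebesgue2S2 fp Ap => y fpy Apy _; rewrite fpy// -Apy.
exact: (congr1 (@^~ x) E).
Qed.
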